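(* Let $p$ be a prime, $q=p^h$, and $0\le j<k<n$. The code $\mathcal{C}_{j,k}(n,q)$ is equivalent to a cyclic code if and only if $j=0$.
   Context: $\textnormal{PG}(n,q)$ is the Desarguesian projective space over $\mathbb F_q$; $G_j$ is its set of $j$-spaces and $V(j,n,q)=\mathbb F_p^{G_j}$. A $k$-space $\kappa$ is identified with $\kappa^{(j)}\in V(j,n,q)$, $\kappa^{(j)}(\lambda)=1$ if $\lambda\subseteq\kappa$, $0$ otherwise, and $\mathcal{C}_{j,k}(n,q)$ is the $\mathbb F_p$-span of all $\kappa^{(j)}$ with $\kappa$ a $k$-space. $\mathcal{C}_{j,k}(n,q)$ is equivalent to a cyclic code if there is an ordering $G_j=\{\lambda_1,\dots,\lambda_g\}$ (with $\lambda_0:=\lambda_g$) such that for every $c\in\mathcal{C}_{j,k}(n,q)$, the function $R(c)$ defined by $R(c)(\lambda_i)=c(\lambda_{i-1})$ also lies in $\mathcal{C}_{j,k}(n,q)$. *)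

(* Defs.v *)
From HB Require Import structures.
From mathcomp Require Import all_boot all_order all_algebra.

Set Implicit Arguments.
Unset Strict Implicit.
Unset Printing Implicit Defensive.

Import GRing.Theory.
Local Open Scope ring_scope.

(* Subspaces of a finite-dimensional space over a finite field form a finite
   type, through their canonical matrix representatives. *)
HB.instance Definition _ (F : finFieldType) (vT : vectType F) :=
  isCountable.Build {vspace vT}
    (pcan_pickleK (can_pcan (@VectorInternalTheory.vs2mxK F vT))).
HB.instance Definition _ (F : finFieldType) (vT : vectType F) :=
  isFinite.Build {vspace vT}
    (pcan_enumP (can_pcan (@VectorInternalTheory.vs2mxK F vT))).

(* PG(n, F) is the lattice of linear subspaces of F^(n+1); a j-space has
   projective dimension j, hence vector dimension j + 1. *)
Definition pspace (j n : nat) (F : finFieldType) : Type :=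
  {U : {vspace 'rV[F]_n.+1} | \dim U == j.+1}.

(* ('F_p)^o is F_p as a vector space over itself. *)
Notation fspace p j n F := {ffun pspace j n F -> ('F_p)^o}.

Definition incvec (p j k n : nat) (F : finFieldType) (kappa : pspace k n F) :
    fspace p j n F :=
  [ffun lambda : pspace j n F => (val lambda <= val kappa)%VS%:R].

Definition pcode (p j k n : nat) (F : finFieldType) : {vspace fspace p j n F} :=
  <<[seq incvec p j kappa | kappa : pspace k n F]>>%VS.

(* [prev s x] is the element preceding x in s read cyclically, so for
   s = [:: l_1; ..; l_g] this is R(c)(l_i) = c(l_(i-1)) with l_0 = l_g. *)
Definition cyclic_shift (T : finType) (V : Type) (s : seq T)
    (c : {ffun T -> V}) : {ffun T -> V} :=
  [ffun x => c (prev s x)].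

Definition cyclic_equivalent (K : fieldType) (T : finType)
    (C : {vspace {ffun T -> K^o}}) : Prop :=
  exists2 s : seq T, uniq s /\ (forall x : T, x \in s) &
    forall c : {ffun T -> K^o}, c \in C -> cyclic_shift s c \in C.

(* Main.v *)
(* For [j = 0], a Singer cycle (multiplication by a primitive element of the extension
   of degree [n + 1] of [F]) permutes the points in one cycle and maps [k]-spaces to
   [k]-spaces.

   For [j > 0], let [rho] be the successor map of a cyclic ordering preserving the code.
   The supports of the nonzero codewords of minimal weight are exactly the sets of
   [j]-spaces of a [k]-space: the part of a codeword [c] above a [(j-1)-space] [mu] has
   constant sum on all subspaces of complementary dimension through [mu], so the
   Bose-Burton argument bounds its support, and counting flags bounds the support of [c].
   Hence [rho] preserves the relation "[x], [y], [z] lie in a common [(j+1)-space]", and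
   so it permutes the tops (all [j]-spaces in a given [(j+1)-space]) and the stars (all
   [j]-spaces through a given [(j-1)-space]).  The cyclic group generated by [rho] is
   regular; a top or star through [x] with nontrivial stabiliser is an orbit of the unique
   subgroup of its order, so some top and some star through [x] have trivial stabiliser.
   On the pencil in which they meet, commutativity produces a triangle whose three
   vertices lie in the top or in the star, which contradicts triviality of the
   stabiliser. *)

Require Import Defs.
From mathcomp Require Import all_boot all_order all_algebra.
From mathcomp Require Import all_fingroup all_solvable all_field zify.

Set Implicit Arguments. Unset Strict Implicit. Unset Printing Implicit Defensive.
Import GRing.Theory.

(** * Subspaces one dimension above a given one: counting and avoiding them *)

Section Covers.

Variables (F : finFieldType) (m : nat).
Local Notation V := 'rV[F]_m.
Local Notation q := #|F|.
Implicit Types (U W mu lambda tau : {vspace V}) (L : {set {vspace V}}).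

Definition covers U W := (U <= W)%VS && (\dim W == (\dim U).+1).

(** The number of points of a projective space of vector dimension [e], as a sum so that no division
    by [q - 1] occurs. *)
Definition points_count e := \sum_(i < e) q ^ i.

Lemma card_field_gt1 : 1 < q. Proof. exact: finNzRing_gt1. Qed.

Lemma points_countS e : points_count e.+1 = points_count e + q ^ e.
Proof. exact: big_ord_recr. Qed.

Lemma leq_points_count d e : d <= e -> points_count d <= points_count e.
Proof.
elim: e => [|e IHe]; first by rewrite leqn0 => /eqP->.
rewrite leq_eqVlt => /predU1P[-> // | /IHe/leq_trans-> //].
by rewrite points_countS leq_addr.
Qed.

Lemma points_count_gt0 e : 0 < points_count e.+1.
Proof.
by apply: leq_trans (leq_points_count (ltn0Sn e)); rewrite /points_count big_ord1.
Qed.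

(** Splits a space of dimension [d + e] into a subspace of dimension [d] and the rest of each of its
    covers; this converts counts of covers into counts of vectors. *)
Lemma points_count_exp d e :
  q ^ d + points_count e * (q ^ d.+1 - q ^ d) = q ^ (d + e).
Proof.
elim: e => [|e IHe]; first by rewrite /points_count big_ord0 !addn0.
rewrite points_countS mulnDl addnA IHe addnS mulnBr -!expnD addnS.
by rewrite [e + d]addnC subnKC // leq_exp2l // card_field_gt1.
Qed.

Lemma dim_add_line U v : v \notin U -> \dim (U + <[v]>) = (\dim U).+1.
Proof.
move=> U'v; have v_neq0: v != 0%R by apply: contraNneq U'v => ->; apply: mem0v.
rewrite dimv_disjoint_sum ?dim_vline ?v_neq0 ?addn1 //.
apply/eqP; rewrite -subv0; apply/subvP=> w; rewrite memv_cap memv0 => /andP[Uw].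
case/vlineP=> a Dw; apply: contraNT U'v => w_neq0.
have a_neq0: a != 0%R by apply: contraNneq w_neq0 => a0; rewrite Dw a0 scale0r.
by rewrite -(scalerK a_neq0 v) -Dw memvZ.
Qed.

Lemma covers_add_line U v : v \notin U -> covers U (U + <[v]>).
Proof. by move=> U'v; rewrite /covers addvSl dim_add_line /=. Qed.

Lemma coversE U W W' : covers U W -> ~~ (W' <= U)%VS -> (W' <= W)%VS ->
  (U + W' = W)%VS.
Proof.
case/andP=> sUW /eqP dimW nsW'U sW'W.
have sUW'W: (U + W' <= W)%VS by rewrite subv_add sUW.
apply/eqP; rewrite eqEdim sUW'W dimW ltnNge.
by rewrite (geq_leqif (dimv_leqif_sup (addvSl U W'))) subv_add subvv.
Qed.

Lemma covers_line U W v : covers U W -> v \in W -> v \notin U ->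
  (U + <[v]> = W)%VS.
Proof. by move=> cUW Wv U'v; apply: coversE; rewrite // -memvE. Qed.

Lemma card_vspace_diff U W : (U <= W)%VS ->
  #|[set v : V | (v \notin U) && (v \in W)]| = q ^ \dim W - q ^ \dim U.
Proof.
move=> sUW; pose A := [set v : V | v \in U]; pose B := [set v : V | v \in W].
have sAB : A \subset B by apply/subsetP=> v; rewrite !inE; apply/subvP.
rewrite -!card_vspace -[#|W|]cardsE -[#|U|]cardsE -/A -/B.
by rewrite -(setIidPr sAB) -cardsD; apply: eq_card => v; rewrite !inE.
Qed.

(** A vector [v] outside [U] lies in exactly one cover of [U], namely [U + <[v]>]. *)
Lemma card_union_covers U L : {in L, forall W, covers U W} ->
  #|[set v : V | (v \notin U) && [exists W in L, v \in W]]|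
    = #|L| * (q ^ (\dim U).+1 - q ^ \dim U).
Proof.
move=> covL; rewrite -sum1_card.
rewrite (partition_big (fun v : V => U + <[v]>)%VS (mem L)) /=; last first.
  move=> v; rewrite inE => /andP[U'v /exists_inP[W LW Wv]].
  by rewrite (covers_line (covL W LW)).
rewrite -sum_nat_const; apply: eq_bigr => W LW; rewrite sum1_card.
have cUW := covL W LW; have /andP[sUW /eqP dimW] := cUW.
rewrite -dimW -(card_vspace_diff sUW); apply: eq_card => v.
rewrite unfold_in !inE; apply/idP/idP => [/andP[/andP[-> _] /eqP <-] | ].
  by rewrite memvE addvSr.
case/andP=> U'v Wv; rewrite U'v (covers_line cUW) // eqxx andbT.
by apply/exists_inP; exists W.
Qed.

Lemma card_covers U tau : (U <= tau)%VS ->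
  #|[set W | covers U W && (W <= tau)%VS]| = points_count (\dim tau - \dim U).
Proof.
move=> sUt; set L := [set _ | _].
have pos : 0 < q ^ (\dim U).+1 - q ^ \dim U.
  by rewrite subn_gt0 ltn_exp2l // card_field_gt1.
apply/eqP; rewrite -(eqn_pmul2r pos) -card_union_covers; last first.
  by move=> W; rewrite inE => /andP[].
rewrite -(eqn_add2l (q ^ \dim U)) points_count_exp subnKC ?dimvS //.
rewrite -(subnKC (_ : q ^ \dim U <= q ^ \dim tau)); last first.
  by rewrite leq_exp2l ?dimvS // card_field_gt1.
rewrite -(card_vspace_diff sUt) eqn_add2l; apply/eqP/eq_card => v.
rewrite !inE; apply: andb_id2l => U'v.
apply/exists_inP/idP => [[W] | tv].
  by rewrite inE => /andP[_ sWt]; apply/subvP.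
exists (U + <[v]>)%VS; last by rewrite memvE addvSr.
by rewrite inE covers_add_line //= subv_add sUt -memvE.
Qed.

Lemma cover_between U W : (U <= W)%VS -> \dim U < \dim W ->
  exists2 X, covers U X & (X <= W)%VS.
Proof.
move=> sUW; rewrite ltnNge (geq_leqif (dimv_leqif_sup sUW)) => /subvPn[v Wv U'v].
by exists (U + <[v]>)%VS; [apply: covers_add_line | rewrite subv_add sUW -memvE].
Qed.

Lemma subspace_between U W d : (U <= W)%VS -> \dim U <= d <= \dim W ->
  exists X, [/\ (U <= X)%VS, \dim X = d & (X <= W)%VS].
Proof.
move=> sUW /andP[]; elim: d => [|d IHd].
  by rewrite leqn0 => /eqP dimU _; exists U; rewrite subvv.
rewrite leq_eqVlt => /predU1P[dimU _|leUd ltdW]; first by exists U; rewrite subvv.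
have [X [sUX dimX sXW]] := IHd leUd (ltnW ltdW).
have [|Y cXY sYW] := cover_between sXW; first by rewrite dimX.
have /andP[sXY /eqP dimY] := cXY.
by exists Y; rewrite (subv_trans sUX) // dimY dimX.
Qed.

(** A member [W] of [L] spoils a single cover of [U], namely [U + W], and [U] has more covers than
    [L] has members. *)
Lemma cover_avoiding mu U L :
    {in L, forall W, covers mu W && ~~ (W <= U)%VS} -> (mu <= U)%VS ->
    #|L| < points_count (m - \dim U) ->
  exists2 W, covers U W & {in L, forall lambda, ~~ (lambda <= W)%VS}.
Proof.
move=> covL smuU ltL; pose bad := [set (U + W)%VS | W in L].
have := card_covers (subvf U); rewrite dimvf /dim /= mul1n.
set C := [set _ | _] => cardC.
have /subsetPn[W] : ~~ (C \subset bad).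
  apply: contraTN ltL => /subset_leq_card; rewrite cardC -leqNgt.
  by move/leq_trans; apply; apply: leq_imset_card.
rewrite inE subvf andbT => cUW badW; exists W => // lambda Ll.
apply: contra badW => slW; apply/imsetP; exists lambda => //.
by have /andP[_ nslU] := covL lambda Ll; rewrite (coversE cUW).
Qed.

(** Climbs with [cover_avoiding] one dimension at a time. Covers are fewest at the last step, from
    [D - 1] to [D], which fixes the bound on [#|L|]. *)
Lemma subspace_avoiding mu U L D :
    {in L, forall W, covers mu W && ~~ (W <= U)%VS} -> (mu <= U)%VS ->
    \dim U <= D <= m -> #|L| < points_count (m - D).+1 ->
  exists W, [/\ (U <= W)%VS, \dim W = D & {in L, forall lambda, ~~ (lambda <= W)%VS}].
Proof.
move=> covL smuU /andP[leUD leDm] ltL.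
move DUi: (D - \dim U) => i.
elim: i U DUi covL smuU leUD => [|i IHi] U DUi covL smuU leUD.
  move/eqP: DUi; rewrite subn_eq0 => leDU; exists U; split=> //.
    by apply/eqP; rewrite eqn_leq leUD.
  by move=> W /covL/andP[].
have [|W cUW avL] := cover_avoiding covL smuU.
  by apply: leq_trans ltL _; apply: leq_points_count; lia.
have /andP[sUW /eqP dimW] := cUW.
have [||||W' [sWW' dimW' avL']] := IHi W; try lia.
- by move=> lambda Ll; rewrite avL //; have /andP[->] := covL _ Ll.
- exact: subv_trans sUW.
by exists W'; split=> //; apply: subv_trans sWW'.
Qed.

End Covers.

(** * Counting subspaces through chains of covers *)

Section Flags.

Variables (F : finFieldType) (m : nat).
Implicit Types (U W beta kappa lambda : {vspace 'rV[F]_m}) (S : {set {vspace 'rV[F]_m}}).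

Definition above S beta := [set lambda in S | (beta <= lambda)%VS].

(** Counts pairs [beta' <= lambda] in two ways: each [lambda] contains [points_count F i] covers of
    [beta]. *)
Lemma sum_card_above S beta i : {in S, forall lambda, \dim lambda = \dim beta + i} ->
  \sum_(beta' | covers beta beta') #|above S beta'|
    = #|above S beta| * points_count F i.
Proof.
move=> dimS; under eq_bigr do rewrite -sum1_card.
rewrite (exchange_big_dep (mem (above S beta))) /= => [|beta' lambda]; last first.
  rewrite !inE => /andP[sbb' _] /andP[-> sb'l].
  by rewrite (subv_trans sbb').
rewrite -sum_nat_const; apply: eq_bigr => lambda; rewrite inE => /andP[Sl sbl].
rewrite sum1_card -[i](addKn (\dim beta)) -(dimS _ Sl) -(card_covers sbl).
by apply: eq_card => beta'; rewrite unfold_in !inE Sl.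
Qed.

(* [flag_count d i / flag_count 0 i] is the Gaussian binomial of [d + i] over [i]. *)
Definition flag_count d i := \prod_(e < i) points_count F (d + e).+1.

Lemma flag_countS d i : flag_count d i.+1 = flag_count d i * points_count F (d + i).+1.
Proof. exact: big_ord_recr. Qed.

Lemma flag_count_gt0 d i : 0 < flag_count d i.
Proof. by apply: prodn_gt0 => e; apply: points_count_gt0. Qed.

Definition subspaces_of J kappa := [set lambda | (\dim lambda == J) && (lambda <= kappa)%VS].

(** Induction on [i] through the covers of [beta]; those outside [kappa] contribute nothing. *)
Lemma card_subspaces_above d i beta kappa :
    (beta <= kappa)%VS -> \dim kappa = \dim beta + i + d ->
  #|above (subspaces_of (\dim beta + i) kappa) beta| * flag_count 0 i = flag_count d i.
Proof.
elim: i beta => [|i IHi] beta sbk dimk.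
  rewrite /flag_count !big_ord0 muln1 (_ : above _ _ = [set beta]) ?cards1 //.
  apply/setP=> lambda; rewrite !inE addn0.
  apply/andP/eqP => [[/andP[/eqP diml _] sbl] | -> //]; last by rewrite eqxx sbk.
  by apply/esym/eqP; rewrite eqEdim sbl diml leqnn.
have dimS : {in subspaces_of (\dim beta + i.+1) kappa,
    forall lambda, \dim lambda = \dim beta + i.+1}.
  by move=> lambda; rewrite inE => /andP[/eqP].
rewrite !flag_countS add0n [flag_count 0 i * _]mulnC mulnA -(sum_card_above dimS).
rewrite big_distrl /= (bigID (fun beta' => beta' <= kappa)%VS) /=.
rewrite [X in _ + X]big1 ?addn0 => [|beta' /andP[_ nsb'k]]; last first.
  apply/eqP; rewrite muln_eq0 cards_eq0; apply/orP; left; rewrite -subset0.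
  apply/subsetP=> lambda; rewrite !inE => /andP[/andP[_ slk] sb'l].
  by rewrite (subv_trans sb'l) in nsb'k.
rewrite (eq_bigr (fun _ => flag_count d i)) => [|beta' /andP[/andP[_ /eqP dimb'] sb'k]].
  rewrite sum_nat_const mulnC; congr (_ * _).
  rewrite (_ : (d + i).+1 = \dim kappa - \dim beta) -?(card_covers sbk).
    by apply: eq_card => beta'; rewrite unfold_in !inE.
  by rewrite dimk -addnA addKn addSn addnC.
by rewrite addnS -addSn -dimb' IHi // dimk dimb' addnS !addSn.
Qed.

End Flags.

(** * Minimal supports *)

Section Weight.

Variables (F : finFieldType) (m : nat) (R : zmodType).
Local Notation V := 'rV[F]_m.
Local Notation q := #|F|.
Implicit Types (U W mu beta kappa lambda sigma : {vspace V}).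
Variables (J K : nat) (c : {vspace V} -> R).

(* If [c] is a combination of [K]-spaces [kappa] with coefficients in characteristic
   [p], then [a] is the sum of the coefficients of the [kappa] containing [mu]:
   [sigma :&: kappa] has dimension at least [J], so the number of spaces covering [mu]
   in it is [1] mod [p]. *)
Definition balanced := forall mu, (\dim mu).+1 = J ->
  exists a, forall sigma, (mu <= sigma)%VS -> \dim sigma + K = m + J ->
    (\sum_(lambda | covers mu lambda && (lambda <= sigma)%VS) c lambda = a)%R.

Hypotheses (leJK : J <= K) (ltKm : K < m) (balc : balanced).

Section Star.

Variables (mu lambda0 : {vspace V}).
Hypotheses (dim_mu : (\dim mu).+1 = J) (cov0 : covers mu lambda0).
Hypothesis c0 : c lambda0 != 0%R.

Let L := [set lambda | covers mu lambda & c lambda != 0%R].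
Let pc := points_count F (K - \dim mu).

Let D := m + J - K.

Let addDK : D + K = m + J. Proof. by rewrite subnK // (leq_trans (ltnW ltKm)) ?leq_addr. Qed.

Let ltJD : J < D. Proof. by rewrite -(ltn_add2r K) addDK addnC ltn_add2r. Qed.

Let leDm : D <= m. Proof. by rewrite -(leq_add2r K) addDK leq_add2l. Qed.

Let subD : m - D.-1 = K - \dim mu.
Proof. by move: addDK leDm ltJD leJK; rewrite -dim_mu; clear; lia. Qed.

Let subDS : (m - D).+1 = K - \dim mu.
Proof. by rewrite -subD; move: addDK leDm ltJD; clear; lia. Qed.

Let L0 : lambda0 \in L. Proof. by rewrite inE cov0. Qed.

Let covL : {in L, forall W, covers mu W}.
Proof. by move=> W; rewrite inE => /andP[]. Qed.

Let covL_sub U W : W \in L -> \dim U = J -> (W <= U)%VS -> W = U.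
Proof.
move=> LW dimU sWU; apply/eqP; rewrite eqEdim sWU dimU -dim_mu.
by have /andP[_ /eqP->] := covL LW; rewrite /=.
Qed.

Let dimL W : W \in L -> \dim W = J.
Proof. by move/covL=> /andP[_ /eqP->]. Qed.

(* If the constant of [balanced] is 0, then [L] without [lambda0] still meets
   every subspace above [lambda0], so [L] is too large. *)
Lemma star_blocking sigma : #|L| <= pc -> (mu <= sigma)%VS ->
  \dim sigma + K = m + J -> exists2 lambda, lambda \in L & (lambda <= sigma)%VS.
Proof.
move=> leLpc sms dims; apply/exists_inP; apply: contraLR leLpc.
rewrite -ltnNge => avs; have [a Da] := balc dim_mu.
have a0 : a = 0%R.
  rewrite -(Da _ sms dims) big1 // => W /andP[cW sWs].
  apply/eqP; apply: contraNT avs => cW0; apply/exists_inP; exists W => //.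
  by rewrite inE cW.
rewrite (cardsD1 lambda0) L0 add1n ltnNge; apply/negP => ltL.
have [||||W [sW dimW avW]] := @subspace_avoiding _ _ mu lambda0 (L :\ lambda0) D.
- move=> W /setD1P[W0 LW]; rewrite covL //; apply: contraNN W0 => sW0.
  by rewrite (covL_sub LW (dimL L0) sW0).
- by case/andP: cov0.
- by rewrite (dimL L0) leDm ltnW.
- by rewrite subDS.
have smW : (mu <= W)%VS by apply: subv_trans sW; case/andP: cov0.
have := Da W smW; rewrite dimW => /(_ addDK); rewrite a0.
rewrite (bigD1 lambda0) ?cov0 //= big1 ?addr0 => [/eqP|U /andP[/andP[cU sUW] U0]].
  by rewrite (negPf c0).
apply/eqP; apply: contraTT sUW => cU0.
by apply: avW; rewrite !inE U0 cU.
Qed.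

(** Fewer members could all be avoided by a [D]-dimensional space through [mu], against
    [star_blocking]. *)
Lemma star_card : pc <= #|L|.
Proof.
rewrite leqNgt; apply/negP => ltL.
have [||||W [sW dimW avW]] := @subspace_avoiding _ _ mu mu L D.
- move=> W LW; rewrite covL //; apply/negP => /dimvS.
  by rewrite (dimL LW) -dim_mu ltnn.
- exact: subvv.
- by rewrite leDm andbT (leq_trans _ (ltnW ltJD)) // -dim_mu.
- by rewrite subDS.
have [|lambda Ll slW] := star_blocking (ltnW ltL) sW; first by rewrite dimW.
by have := avW _ Ll; rewrite slW.
Qed.

(** Extremal case of the Bose-Burton argument. If [x + y] is uncovered, some [U] of dimension
    [D - 1] through [mu] and [x + y] avoids [L]. One of its covers [W] avoids all of [L] but
    [lambda2]; blocking puts [lambda2], hence [y] and then [x], into [W], so [lambda1] lies in [W]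
    too, a contradiction. *)
Lemma star_add x y lambda1 lambda2 : #|L| <= pc ->
    lambda1 \in L -> lambda2 \in L -> x \in lambda1 -> y \in lambda2 ->
  [exists lambda in L, (x + y)%R \in lambda].
Proof.
move=> leL L1 L2 l1x l2y; apply: contraT => /exists_inPn avxy.
have [sm1 sm2] : (mu <= lambda1)%VS /\ (mu <= lambda2)%VS.
  by split; [case/andP: (covL L1) | case/andP: (covL L2)].
have mu'xy : (x + y)%R \notin mu by apply: contra (avxy _ L1) => /(subvP sm1).
have mu'x : x \notin mu.
  by apply: contra (avxy _ L2) => mux; rewrite memvD // (subvP sm2).
have [||||U [sU dimU avU]] :=
    @subspace_avoiding _ _ mu (mu + <[(x + y)%R]>) L D.-1.
- move=> W LW; rewrite covL //; apply: contra (avxy _ LW) => sW.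
  rewrite (covL_sub LW _ sW) ?dim_add_line //.
  by rewrite memvE addvSr.
- exact: addvSl.
- by rewrite dim_add_line // dim_mu -ltnS (ltn_predK ltJD) ltJD (leq_trans (leq_pred _)).
(* One dimension below [D] the bound gains a power of [q], so the whole of [L] can be avoided. *)
- apply: leq_ltn_trans leL _; rewrite subD /pc points_countS -[ltnLHS]addn0.
  by rewrite ltn_add2l expn_gt0 (ltnW (card_field_gt1 F)).
have smU : (mu <= U)%VS by apply: subv_trans sU; apply: addvSl.
have Uxy : (x + y)%R \in U by apply: (subvP sU); rewrite memvE addvSr.
have [|||W cUW avW] := @cover_avoiding _ _ mu U (L :\ lambda2).
- by move=> W /setD1P[_ LW]; rewrite covL ?avU.
- exact: smU.
- by rewrite dimU subD; move: leL; rewrite (cardsD1 lambda2) L2 add1n.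
have /andP[sUW /eqP dimW] := cUW.
have [|lambda Ll slW] := star_blocking leL (subv_trans smU sUW).
  by rewrite dimW dimU (ltn_predK ltJD).
have El : lambda = lambda2.
  by apply/eqP; apply: contraLR slW => l2; apply: avW; rewrite in_setD1 l2.
have Wx : x \in W.
  rewrite -[x](addrK y); apply: memvB; first exact: subvP Uxy.
  by apply: (subvP slW); rewrite El.
have : (lambda1 <= W)%VS.
  rewrite -(covers_line (covL L1) l1x mu'x) subv_add (subv_trans smU sUW).
  by rewrite -memvE.
apply/contraTT => _; apply: avW; rewrite in_setD1 L1 andbT.
by apply: contraNneq (avxy _ L2) => E12; rewrite memvD // -E12.
Qed.

Let Z := [set v : V | [exists lambda in L, v \in lambda]].

Let card_Z : #|Z| = q ^ \dim mu + #|L| * (q ^ (\dim mu).+1 - q ^ \dim mu).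
Proof.
rewrite -(card_union_covers covL) -(cardsID [set v in mu] Z) (setIidPr _).
  rewrite -card_vspace -[X in _ = X + _]cardsE; congr (_ + _).
  by apply: eq_card => v; rewrite !inE.
apply/subsetP=> v; rewrite !inE => muv; apply/exists_inP; exists lambda0 => //.
by apply: subvP muv; case/andP: cov0.
Qed.

Let card_Z_exp : q ^ \dim mu + pc * (q ^ (\dim mu).+1 - q ^ \dim mu) = q ^ K.
Proof. by rewrite points_count_exp subnKC // (leq_trans _ leJK) // -dim_mu. Qed.

Lemma star_cover_card : q ^ K <= #|Z|.
Proof. by rewrite card_Z -card_Z_exp leq_add2l leq_mul2r star_card orbT. Qed.

(** By [star_add] the set [Z] is closed under addition, so it is the sum of the members of [L];
    counting vectors then gives the dimension. *)
Lemma star_cover_subspace : #|Z| <= q ^ K ->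
  exists2 kappa, \dim kappa = K & kappa =i Z.
Proof.
move=> leZ; have leL : #|L| <= pc.
  move: leZ; rewrite card_Z -card_Z_exp leq_add2l leq_pmul2r // subn_gt0.
  by rewrite ltn_exp2l // card_field_gt1.
pose kappa := (\sum_(lambda in L) lambda)%VS; have kZ : kappa =i Z.
  move=> v; rewrite inE; apply/memv_sumP/exists_inP => [[vs Lvs ->] | [lambda Ll lv]].
    elim/big_rec: _ => [|lambda w Ll [lambda' Ll' l'w]].
      by exists lambda0; rewrite ?mem0v.
    by apply/exists_inP; apply: star_add (Lvs _ Ll) l'w.
  by apply/memv_sumP; move: v lv; apply/subvP; apply: sumv_sup (subvv _).
exists kappa => //; apply/eqP; rewrite -(eqn_exp2l _ _ (card_field_gt1 F)).
by rewrite -card_vspace (eq_card kZ) eqn_leq leZ star_cover_card.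
Qed.

End Star.

Definition support := [set lambda | (\dim lambda == J) & c lambda != 0%R].

Let S := support.

Let covered beta := [set v : V | [exists lambda in above S beta, v \in lambda]].

(** Reduces to some [mu] of dimension [J - 1] between [beta] and a member of the support:
    [covered beta] contains all that is covered above [mu], and at equal size the two coincide. *)
Lemma covered_card beta : above S beta != set0 -> \dim beta < J ->
  q ^ K <= #|covered beta| /\
  (#|covered beta| <= q ^ K ->
     exists2 kappa, \dim kappa = K & kappa =i covered beta).
Proof.
case/set0Pn=> lambda0; rewrite !inE => /andP[/andP[/eqP dim0 c0] sb0] ltbJ.
have [mu [sbm dim_mu avmu]] : exists mu,
    [/\ (beta <= mu)%VS, (\dim mu).+1 = J & (mu <= lambda0)%VS].
  case: J ltbJ dim0 => // j ltbj dim0.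
  have [|mu [sbm dim_mu sml]] := @subspace_between _ _ _ _ j sb0.
    by rewrite dim0 -ltnS ltbj leqnSn.
  by exists mu; split=> //; congr _.+1.
have cov0 : covers mu lambda0 by rewrite /covers avmu dim0 dim_mu /=.
have geZ := star_cover_card dim_mu cov0 c0.
have subZ := star_cover_subspace dim_mu cov0 c0.
set Z := [set v : V | _] in geZ subZ.
have sZ : Z \subset covered beta.
  apply/subsetP=> v; rewrite !inE => /exists_inP[lambda].
  rewrite inE => /andP[/andP[sml /eqP diml] cl] lv; apply/exists_inP; exists lambda => //.
  by rewrite !inE diml dim_mu eqxx cl (subv_trans sbm).
split=> [|leZ]; first exact: leq_trans (subset_leq_card sZ).
have EZ : Z = covered beta by apply/eqP; rewrite eqEcard sZ (leq_trans leZ).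
by rewrite -EZ; apply: subZ; rewrite EZ.
Qed.

Let covered_covers beta :=
  [set beta' | covers beta beta' & above S beta' != set0].

Lemma covered_covers_card beta : above S beta != set0 -> \dim beta < J ->
  #|covered beta| = q ^ \dim beta +
    #|covered_covers beta| * (q ^ (\dim beta).+1 - q ^ \dim beta).
Proof.
case/set0Pn=> lambda0 l0 ltbJ.
have cov : {in covered_covers beta, forall W, covers beta W}.
  by move=> W; rewrite inE => /andP[].
rewrite -(card_union_covers cov) -(cardsID [set v in beta]) (setIidPr _).
  rewrite -card_vspace -[X in _ = X + _]cardsE; congr (_ + _).
  apply: eq_card => v; rewrite !inE; apply: andb_id2l => b'v.
  apply/exists_inP/exists_inP => [[lambda]|[W]].
    rewrite inE => /andP[Sl sbl] lv; exists (beta + <[v]>)%VS; last by rewrite memvE addvSr.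
    rewrite inE covers_add_line //; apply/set0Pn; exists lambda.
    by rewrite inE Sl subv_add sbl -memvE.
  rewrite inE => /andP[/andP[sbW _] /set0Pn[lambda]]; rewrite inE => /andP[Sl sWl] Wv.
  exists lambda; last exact: subvP Wv.
  by rewrite inE Sl (subv_trans sbW).
apply/subsetP=> v; rewrite !inE => bv; apply/exists_inP; exists lambda0 => //.
by apply: subvP bv; move: l0; rewrite inE => /andP[].
Qed.

Lemma covered_covers_ge beta : above S beta != set0 -> \dim beta < J ->
  points_count F (K - \dim beta) <= #|covered_covers beta|.
Proof.
move=> nz ltbJ; have [leZ _] := covered_card nz ltbJ.
rewrite -(leq_pmul2r (_ : 0 < q ^ (\dim beta).+1 - q ^ \dim beta)); last first.
  by rewrite subn_gt0 ltn_exp2l // card_field_gt1.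
rewrite -(leq_add2l (q ^ \dim beta)) -covered_covers_card // points_count_exp.
by rewrite subnKC // (leq_trans (ltnW ltbJ)).
Qed.

(** Double counting over the covers of [beta]. The size of [covered_covers beta] stays explicit
    because [card_above_ge] bounds it from below and [min_support] from above. *)
Lemma sum_above_ge beta i : \dim beta + i.+1 = J ->
    (forall beta', covers beta beta' -> above S beta' != set0 ->
       flag_count F (K - J) i <= #|above S beta'| * flag_count F 0 i) ->
  #|covered_covers beta| * flag_count F (K - J) i
    <= #|above S beta| * flag_count F 0 i.+1.
Proof.
move=> dimb ge'; have dimS : {in S, forall lambda, \dim lambda = \dim beta + i.+1}.
  by move=> lambda; rewrite inE dimb => /andP[/eqP].
rewrite flag_countS add0n [flag_count _ 0 i * _]mulnC mulnA -(sum_card_above dimS).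
rewrite -sum_nat_const big_distrl /=.
rewrite [leqRHS](bigID (fun beta' => above S beta' != set0)) /= -[leqLHS]addn0.
apply: leq_add => //; rewrite (eq_bigl _ _ (fun=> in_set _ _)).
by apply: leq_sum => beta' /andP[cov nz]; apply: ge'.
Qed.

(** Induction from [beta] to its covers; by [card_subspaces_above] a [K]-dimensional space attains
    the bound. *)
Lemma card_above_ge beta i : \dim beta + i = J -> above S beta != set0 ->
  flag_count F (K - J) i <= #|above S beta| * flag_count F 0 i.
Proof.
elim: i beta => [|i IHi] beta dimb nz.
  by rewrite /flag_count !big_ord0 muln1 card_gt0.
apply: leq_trans (sum_above_ge dimb _).
  rewrite flag_countS mulnC leq_mul2r orbC.
  rewrite (_ : (K - J + i).+1 = K - \dim beta) ?covered_covers_ge //.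
    by rewrite -dimb addnS ltnS leq_addr.
  by move: dimb leJK; clear; lia.
move=> beta' /andP[_ /eqP dimb'] nz'; apply: IHi => //.
by rewrite dimb' addSn -addnS.
Qed.

(** So small a support covers at most [points_count F K] one-dimensional spaces, hence at most
    [q ^ K] vectors, which therefore form a subspace [kappa]. The lower bound on [#|S|] then leaves
    no [J]-dimensional subspace of [kappa] out. *)
Lemma min_support kappa0 : 0 < J -> \dim kappa0 = K -> S != set0 ->
    #|S| <= #|subspaces_of J kappa0| ->
  exists2 kappa, \dim kappa = K & S = subspaces_of J kappa.
Proof.
move=> J_gt0 dimk0 nzS leS.
have above0 (A : {set {vspace V}}) : above A 0%VS = A.
  by apply/setP=> W; rewrite inE sub0v andbT.
have nz : above S 0%VS != set0 by rewrite above0.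
have card_sub kappa : \dim kappa = K ->
    #|subspaces_of J kappa| * flag_count F 0 J = flag_count F (K - J) J.
  move=> dimk; have := @card_subspaces_above _ _ (K - J) J 0%VS kappa (sub0v _).
  by rewrite dimv0 add0n subnKC // above0; apply.
have ltJ : \dim (0%VS : {vspace V}) < J by rewrite dimv0.
have [_ /(_ _)[|kappa dimk kZ]] := covered_card nz ltJ.
  rewrite (covered_covers_card nz ltJ).
  have -> : q ^ K = q ^ \dim (0%VS : {vspace V}) + points_count F K *
       (q ^ (\dim (0%VS : {vspace V})).+1 - q ^ \dim (0%VS : {vspace V})).
    by rewrite points_count_exp dimv0.
  rewrite leq_add2l leq_mul2r; apply/orP; right.
  have dimJ : \dim (0%VS : {vspace V}) + J.-1.+1 = J by rewrite dimv0 prednK.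
  rewrite -(leq_pmul2r (flag_count_gt0 F (K - J) J.-1)).
  apply: leq_trans (sum_above_ge dimJ _) _ => [beta' /andP[_ /eqP dimb'] nz'|].
    by apply: card_above_ge => //; rewrite dimb' dimv0 add1n prednK.
  rewrite above0 prednK // (leq_trans (leq_mul leS (leqnn _))) // card_sub //.
  (* The last factor of [flag_count F (K - J) J] is [points_count F K]. *)
  by have := flag_countS F (K - J) J.-1; rewrite -addnS prednK // subnK // mulnC => ->.
exists kappa => //.
have sS : S \subset subspaces_of J kappa.
  apply/subsetP=> lambda Sl; rewrite inE; move: (Sl); rewrite inE => /andP[-> _] /=.
  apply/subvP=> v lv; rewrite kZ inE; apply/exists_inP; exists lambda => //.
  by rewrite above0.
apply/eqP; rewrite eqEcard sS /=.
rewrite -(leq_pmul2r (flag_count_gt0 F 0 J)) card_sub //.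
by rewrite -[in leqRHS](above0 S) card_above_ge // dimv0.
Qed.

End Weight.

(** * Blocks with trivial stabiliser under a regular cyclic group *)

Section FreeBlock.

Variables (T : finType) (G : {group {perm T}}) (BB : {set {set T}}) (e : nat) (x0 : T).
Hypotheses (cycG : cyclic G) (transG : forall x y, exists2 a, a \in G & a x = y).
Hypothesis actBB : {in BB & G, forall (B : {set T}) (a : {perm T}), [set a x | x in B] \in BB}.
Hypotheses (cardBB : {in BB, forall B : {set T}, #|B| = e}).
Hypothesis BB_meet : {in BB &, forall (B B' : {set T}) x y, x != y ->
  x \in B -> y \in B -> x \in B' -> y \in B' -> B = B'}.

(** An element fixing one point commutes with a transitive group, so it fixes all points. *)
Lemma cyclic_semiregular a x : a \in G -> a x = x -> a = 1%g.
Proof.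
move=> Ga ax; apply/permP=> y; rewrite perm1.
have [b Gb <-] := transG x y; rewrite -permM.
by rewrite -(centsP (cyclic_abelian cycG) a Ga b Gb) permM ax.
Qed.

Let stab (B : {set T}) := [set a in G | [set a x | x in B] == B].

Let stab_group (B : {set T}) : group_set (stab B).
Proof.
apply/group_setP; split=> [|a b].
  by rewrite inE group1 (eq_imset _ (@perm1 _)) imset_id eqxx.
rewrite !inE => /andP[Ga /eqP aB] /andP[Gb /eqP bB]; rewrite groupM //=.
by rewrite (eq_imset _ (permM a b)) (imset_comp b a) aB bB.
Qed.

(* For [t = a x0] in [B] and [h != 1] stabilising [B], the blocks [B] and [a B]
   share [t] and [h t = a (h x0)], hence coincide. *)
Let stab_orbit B h : B \in BB -> x0 \in B -> h \in stab B -> h != 1%g ->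
  B = [set a x0 | a : {perm T} in stab B].
Proof.
move=> BBB Bx0 sh h1; have := sh; rewrite inE => /andP[Gh /eqP hB].
have hP y : y \in B -> h y \in B by rewrite -{2}hB; apply: imset_f.
apply/setP=> t; apply/idP/imsetP => [Bt | [a]]; last first.
  by rewrite inE => /andP[_ /eqP <-] ->; rewrite imset_f.
have [a Ga at_] := transG x0 t; exists a => //; rewrite inE Ga /=; apply/eqP.
apply: (BB_meet (actBB BBB Ga) BBB (_ : t != h t)) => //.
- by apply: contraNneq h1 => ht; apply/eqP; apply: cyclic_semiregular (esym ht).
- by rewrite -at_ imset_f.
- rewrite -at_ -permM (centsP (cyclic_abelian cycG) a Ga h Gh) permM imset_f //.
  exact: hP.
exact: hP.
Qed.

Let card_stab B h : B \in BB -> x0 \in B -> h \in stab B -> h != 1%g -> #|stab B| = e.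
Proof.
move=> BBB Bx0 sh h1; rewrite -(cardBB BBB) {2}(stab_orbit BBB Bx0 sh h1).
rewrite card_in_imset // => a b; rewrite !inE => /andP[Ga _] /andP[Gb _] ab.
apply/eqP; rewrite eq_mulVg1; apply/eqP.
apply: (@cyclic_semiregular _ (a x0)); first by rewrite groupM ?groupV.
by rewrite permM permK.
Qed.

(** Nontrivial stabilisers of both blocks would have order [e], so they would coincide in the cyclic
    group [G], and so would the blocks, being their orbits of [x0]. *)
Lemma free_block B1 B2 : B1 \in BB -> B2 \in BB -> B1 != B2 -> x0 \in B1 -> x0 \in B2 ->
  exists B, [/\ B \in BB, x0 \in B &
    {in G, forall a : {perm T}, [set a x | x in B] = B -> a = 1%g}].
Proof.
move=> BB1 BB2 B12 B1x B2x.
have free B : B \in BB -> x0 \in B -> (forall h, h \in stab B -> h = 1%g) ->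
    exists B, [/\ B \in BB, x0 \in B &
    {in G, forall a : {perm T}, [set a x | x in B] = B -> a = 1%g}].
  move=> BBB Bx st; exists B; split=> // a Ga aB; apply: st.
  by rewrite inE Ga aB eqxx.
have [|/exists_inPn st1] := boolP [exists h in stab B1, h != 1%g]; last first.
  by apply: (free B1) => // h /st1; rewrite negbK => /eqP.
have [|/exists_inPn st2 _] := boolP [exists h in stab B2, h != 1%g]; last first.
  by apply: (free B2) => // h /st2; rewrite negbK => /eqP.
case/exists_inP=> h2 sh2 h2n /exists_inP[h1 sh1 h1n].
have sG B : stab B \subset G by apply/subsetP=> a; rewrite inE => /andP[].
have : Group (stab_group B1) == Group (stab_group B2) :> {set {perm T}}.
  rewrite (eq_subG_cyclic cycG) ?sG //=.
  by rewrite (card_stab BB1 B1x sh1 h1n) (card_stab BB2 B2x sh2 h2n).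
move/eqP=> /= E12; case/eqP: B12.
by rewrite (stab_orbit BB1 B1x sh1 h1n) (stab_orbit BB2 B2x sh2 h2n) E12.
Qed.

End FreeBlock.

(** * Tops and stars *)

Section Grassmann.

Variables (j n : nat) (F : finFieldType).
Local Notation V := 'rV[F]_n.+1.
Local Notation point := (pspace j n F).
Implicit Types (x y z w : point) (U W mu tau : {vspace V}).

(** With a repeated argument, [near x y y], this is adjacency or equality in the Grassmann graph, so
    a single invariant relation recovers both tops and stars. *)
Definition near x y z := \dim (val x + val y + val z) <= j.+2.

Lemma dim_point x : \dim (val x) = j.+1.
Proof. exact/eqP/(valP x). Qed.

Lemma point_between U W : (U <= W)%VS -> \dim U <= j.+1 <= \dim W ->
  exists x, (U <= val x <= W)%VS.
Proof.
move=> sUW dims; have [X [sUX /eqP dimX sXW]] := subspace_between sUW dims.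
by exists (Sub X dimX : point); rewrite SubK sUX.
Qed.

Lemma point_eq x y : (val x <= val y)%VS -> x = y.
Proof. by move=> sxy; apply/val_inj/eqP; rewrite eqEdim sxy !dim_point leqnn. Qed.

Lemma dim_join x y : x != y -> j.+2 <= \dim (val x + val y).
Proof.
move=> xy; rewrite ltnNge; apply: contraNN xy => ledim; apply/eqP/esym/point_eq.
have /eqP-> : val x == (val x + val y)%VS by rewrite eqEdim addvSl dim_point.
exact: addvSr.
Qed.

Lemma near_join x y : near x y y = (\dim (val x + val y) <= j.+2).
Proof. by rewrite /near -addvA addvv. Qed.

Lemma dim_near_join x y : x != y -> near x y y -> \dim (val x + val y) = j.+2.
Proof. by rewrite near_join => xy le; apply/eqP; rewrite eqn_leq le dim_join. Qed.

Lemma near_join_eq x y tau : x != y -> \dim tau = j.+2 ->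
  (val x <= tau)%VS -> (val y <= tau)%VS -> tau = (val x + val y)%VS.
Proof.
move=> xy dimt sxt syt; apply/esym/eqP; rewrite eqEdim subv_add sxt syt dimt.
exact: dim_join.
Qed.

Lemma dim_meet x y : x != y -> \dim (val x :&: val y) <= j.
Proof.
move=> xy; have := dim_join xy; have := dimv_sum_cap (val x) (val y).
by rewrite !dim_point; move: (\dim _) (\dim _) => a b; clear; lia.
Qed.

Lemma dim_near_meet x y : x != y -> near x y y -> \dim (val x :&: val y) = j.
Proof.
move=> xy nxy; have := dim_near_join xy nxy; have := dimv_sum_cap (val x) (val y).
by rewrite !dim_point; move: (\dim _) (\dim _) => a b; clear; lia.
Qed.

Lemma near_meet_eq x y mu : x != y -> \dim mu = j ->
  (mu <= val x)%VS -> (mu <= val y)%VS -> mu = (val x :&: val y)%VS.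
Proof.
move=> xy dimm smx smy; apply/eqP; rewrite eqEdim subv_cap smx smy dimm.
exact: dim_meet.
Qed.

Lemma near_of_meet x y mu : \dim mu = j -> (mu <= val x)%VS -> (mu <= val y)%VS ->
  near x y y.
Proof.
move=> dimm smx smy; rewrite near_join.
have : (mu <= val x :&: val y)%VS by rewrite subv_cap smx.
move/dimvS; rewrite dimm; have := dimv_sum_cap (val x) (val y).
by rewrite !dim_point; move: (\dim _) (\dim _) => a b; clear; lia.
Qed.

(** If [z] meets [x] and [y] in different subspaces, these two span [z]; otherwise their common
    value is the meet of [x] and [y]. *)
Lemma near_triple x y z : x != y -> x != z -> y != z ->
    near x y y -> near x z z -> near y z z ->
  (val z <= val x + val y)%VS || (val x :&: val y <= val z)%VS.
Proof.
move=> xy xz yz nxy nxz nyz; have [//|nsz /=] := boolP (_ <= _ + _)%VS.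
have [[dxy dxz] dyz] := (dim_near_meet xy nxy, dim_near_meet xz nxz, dim_near_meet yz nyz).
have [E|ne] := eqVneq (val x :&: val z)%VS (val y :&: val z)%VS.
  rewrite -(_ : val x :&: val z = val x :&: val y)%VS ?capvSr //.
  by apply/eqP; rewrite eqEdim dxy dxz leqnn andbT subv_cap capvSl {1}E capvSl.
case/negP: nsz; set a := (_ :&: _)%VS in dxz ne; set b := (_ :&: _)%VS in dyz ne.
have sab : (a + b <= val z)%VS by rewrite subv_add !capvSr.
have : j < \dim (a + b).
  rewrite ltnNge; apply: contra ne => led.
  have Ea : a = (a + b)%VS by apply/eqP; rewrite eqEdim addvSl dxz.
  have Eb : b = (a + b)%VS by apply/eqP; rewrite eqEdim addvSr dyz.
  by rewrite Ea {2}Eb.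
move=> led; have <- : (a + b)%VS = val z.
  by apply/eqP; rewrite eqEdim sab dim_point.
by apply: addvS; apply: capvSl.
Qed.

Lemma near_top x y z : x != y -> near x y y -> near x y z = (val z <= val x + val y)%VS.
Proof.
move=> xy nxy; have dxy := dim_near_join xy nxy; rewrite /near -dxy.
by rewrite (geq_leqif (dimv_leqif_sup (addvSl _ _))) subv_add subvv.
Qed.

(** Describes a star by [near] alone. A [w] near all three points but not above the meet of [x] and
    [y] would lie in [x + y] and in [x + z]; both then equal [x + w], which forces [z] into
    [x + y]. *)
Lemma near_star x y z w : near x y y -> near x z z -> near y z z -> ~~ near x y z ->
  [&& near w x x, near w y y & near w z z] = (val x :&: val y <= val w)%VS.
Proof.
move=> nxy nxz nyz nxyz.
have xy : x != y by apply: contraNneq nxyz => ->; rewrite /near addvv -near_join.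
have xz : x != z.
  by apply: contraNneq nxyz => E; rewrite /near addvC -E addvA addvv -near_join.
have yz : y != z by apply: contraNneq nxyz => <-.
have nsz : ~~ (val z <= val x + val y)%VS by rewrite -near_top.
have smz : (val x :&: val y <= val z)%VS.
  by have := near_triple xy xz yz nxy nxz nyz; rewrite (negPf nsz).
have dxy := dim_near_meet xy nxy.
apply/and3P/idP => [[nwx nwy nwz] | smw]; last first.
  by split; apply: near_of_meet dxy _ _; rewrite ?capvSl ?capvSr.
have nsym u v : near u v v -> near v u u by rewrite !near_join addvC.
have [->|xw] := eqVneq w x; first exact: capvSl.
have [->|yw] := eqVneq w y; first exact: capvSr.
have [->//|zw] := eqVneq w z.
rewrite ![w == _]eq_sym in xw yw zw.
apply: contraT => nsmw.
have sw1 : (val w <= val x + val y)%VS.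
  have := near_triple xy xw yw nxy (nsym _ _ nwx) (nsym _ _ nwy).
  by rewrite (negPf nsmw) orbF.
have sw2 : (val w <= val x + val z)%VS.
  have := near_triple xz xw zw nxz (nsym _ _ nwx) (nsym _ _ nwz).
  rewrite (_ : val x :&: val z = val x :&: val y)%VS ?(negPf nsmw) ?orbF //.
  by apply/esym/near_meet_eq; rewrite ?capvSl.
case/negP: nsz.
rewrite (near_join_eq xw (dim_near_join xy nxy) (addvSl _ _) sw1).
by rewrite -(near_join_eq xw (dim_near_join xz nxz) (addvSl _ _) sw2) addvSr.
Qed.

Definition top tau : {set point} := [set x : point | (val x <= tau)%VS].
Definition star mu : {set point} := [set x : point | (mu <= val x)%VS].
Definition tops := [set top tau | tau : {vspace V} & \dim tau == j.+2].
Definition stars := [set star mu | mu : {vspace V} & \dim mu == j].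

(** Between [mu] and [tau] lie [q + 1], hence at least three, points. *)
Lemma pencil mu tau x : (mu <= val x)%VS -> (val x <= tau)%VS -> \dim mu = j ->
    \dim tau = j.+2 ->
  exists y z,
    [/\ x != y, x != z & y != z] /\ y \in top tau :&: star mu /\ z \in top tau :&: star mu.
Proof.
move=> smx sxt dimm dimt; set P := top tau :&: star mu.
have : 2 < #|P|.
  have := card_covers (subv_trans smx sxt); rewrite dimt dimm -addn2 addKn.
  rewrite /points_count big_ord_recl big_ord1 expn0 add1n => card3.
  suff -> : #|P| = #|[set W | covers mu W && (W <= tau)%VS]|.
    by rewrite card3 ltnS; apply: card_field_gt1.
  rewrite -(card_imset _ (@val_inj _ _ point)); apply: eq_card => W; rewrite !inE.
  apply/imsetP/andP => [[y] | [/andP[smW]]].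
    by rewrite !inE => /andP[syt smy] ->; rewrite /covers smy dim_point dimm eqxx.
  rewrite dimm => dimW sWt; exists (Sub W dimW : point); last by rewrite SubK.
  by rewrite !inE SubK sWt.
have Px : x \in P by rewrite !inE sxt.
rewrite (cardsD1 x) Px add1n ltnS => /card_gt1P[y [z []]].
rewrite !in_setD1 => /andP[yx Py] /andP[zx Pz] yz; exists y, z.
rewrite eq_sym in yx; rewrite eq_sym in zx.
exact: (conj (And3 yx zx yz) (conj Py Pz)).
Qed.

Variable G : {group {perm point}}.
Hypotheses (cycG : cyclic G) (transG : forall x y, exists2 a, a \in G & a x = y).
Hypothesis near_act : {in G, forall a : {perm point}, forall x y z,
  near x y z -> near (a x) (a y) (a z)}.
Hypotheses (j_gt0 : 0 < j) (ltjn : j.+1 < n).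

Let dimV : \dim (fullv : {vspace V}) = n.+1. Proof. by rewrite dimvf /dim /= mul1n. Qed.

Let ex_notin U : \dim U <= n -> exists v, v \notin U.
Proof.
move=> leU; have : ~~ (fullv <= U)%VS.
  by apply: contraTN leU => /dimvS; rewrite dimV -ltnNge.
by case/subvPn=> v _; exists v.
Qed.

Lemma near_actE a x y z : a \in G -> near (a x) (a y) (a z) = near x y z.
Proof.
move=> Ga; apply/idP/idP; last exact: near_act.
by move/(near_act (groupVr Ga)); rewrite !permK.
Qed.

Let mem_act (a : {perm point}) (B : {set point}) x :
  (x \in [set a y | y in B]) = ((a^-1)%g x \in B).
Proof. by rewrite -{1}(permKV a x) mem_imset //; apply: perm_inj. Qed.

(** Any two distinct points [x], [y] of a top that are near recover it as the set of [z] with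
    [near x y z]. *)
Lemma act_tops : {in tops & G, forall (B : {set point}) (a : {perm point}),
  [set a x | x in B] \in tops}.
Proof.
move=> _ a /imsetP[tau] + -> Ga; rewrite inE => /eqP dimt.
have [|mu [_ dimm smt]] := @subspace_between _ _ 0%VS tau j (sub0v _).
  by rewrite dimv0 dimt (leqW (leqnSn j)).
have [|x /andP[smx sxt]] := @point_between mu tau smt; first by rewrite dimm dimt !leqnSn.
have [y [_ [[xy _ _] [yP _]]]] := pencil smx sxt dimm dimt.
move: yP; rewrite !inE => /andP[syt smy].
have nxy : near x y y := near_of_meet dimm smx smy.
have axy : a x != a y by rewrite (inj_eq perm_inj).
have naxy : near (a x) (a y) (a y) by rewrite near_actE.
apply/imsetP; exists (val (a x) + val (a y))%VS; first by rewrite inE dim_near_join.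
apply/setP=> z; rewrite mem_act !inE -near_top // -{2}(permKV a z) near_actE //.
by rewrite near_top // -(near_join_eq xy dimt).
Qed.

(** [near_star] recovers a star from three of its points not in a common top: [x] and [y] from a
    pencil, [z] through a vector outside the span [tau] of these two. *)
Lemma act_stars : {in stars & G, forall (B : {set point}) (a : {perm point}),
  [set a x | x in B] \in stars}.
Proof.
move=> _ a /imsetP[mu] + -> Ga; rewrite inE => /eqP dimm.
have ltmV : \dim mu <= j.+1 <= \dim (fullv : {vspace V}).
  by rewrite dimm leqnSn dimV ltnW // ltnW.
have [x /andP[smx _]] := point_between (subvf mu) ltmV.
have [|tau [sxt dimt _]] := @subspace_between _ _ (val x) fullv j.+2 (subvf _).
  by rewrite dim_point leqnSn dimV ltnS ltnW.
have [y [_ [[xy _ _] [yP _]]]] := pencil smx sxt dimm dimt.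
move: yP; rewrite !inE => /andP[syt smy].
have [|v t'v] := @ex_notin tau; first by rewrite dimt.
have m'v : v \notin mu by apply: contra t'v; apply/subvP/(subv_trans smx).
have [|z /andP[smz _]] := @point_between (mu + <[v]>) fullv (subvf _).
  by rewrite dim_add_line // dimm leqnn dimV ltnW // ltnW.
have {}smz : (mu <= val z)%VS /\ v \in val z.
  by move: smz; rewrite subv_add -memvE => /andP[].
have [{}smz zv] := smz.
have nxy := near_of_meet dimm smx smy; have nxz := near_of_meet dimm smx smz.
have nyz := near_of_meet dimm smy smz.
have nxyz : ~~ near x y z.
  rewrite near_top // -(near_join_eq xy dimt) //.
  by apply: contra t'v => /subvP; apply.
have axy : a x != a y by rewrite (inj_eq perm_inj).
apply/imsetP; exists (val (a x) :&: val (a y))%VS.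
  by rewrite inE dim_near_meet // near_actE.
apply/setP=> w; rewrite mem_act !inE -(@near_star _ _ (a z)) ?near_actE //.
by rewrite -[w in RHS](permKV a) !near_actE // near_star // -(near_meet_eq xy dimm smx smy).
Qed.

Lemma tops_meet : {in tops &, forall (B B' : {set point}) x y, x != y ->
  x \in B -> y \in B -> x \in B' -> y \in B' -> B = B'}.
Proof.
move=> _ _ /imsetP[t1] + -> /imsetP[t2] + ->; rewrite !inE => /eqP d1 /eqP d2 x y xy.
rewrite !inE => x1 y1 x2 y2.
by rewrite (near_join_eq xy d1 x1 y1) (near_join_eq xy d2 x2 y2).
Qed.

Lemma stars_meet : {in stars &, forall (B B' : {set point}) x y, x != y ->
  x \in B -> y \in B -> x \in B' -> y \in B' -> B = B'}.
Proof.
move=> _ _ /imsetP[m1] + -> /imsetP[m2] + ->; rewrite !inE => /eqP d1 /eqP d2 x y xy.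
rewrite !inE => x1 y1 x2 y2.
by rewrite (near_meet_eq xy d1 x1 y1) (near_meet_eq xy d2 x2 y2).
Qed.

Lemma card_top tau : #|top tau| = #|subspaces_of j.+1 tau|.
Proof.
rewrite -(card_imset _ (@val_inj _ _ point)); apply: eq_card => U; rewrite !inE.
apply/imsetP/andP => [[x] | [dimU sUt]].
  by rewrite inE => sxt ->; split; first exact: (valP x).
by exists (Sub U dimU : point); rewrite ?inE SubK.
Qed.

Lemma card_top_flags tau d : \dim tau = j.+1 + d ->
  #|top tau| * flag_count F 0 j.+1 = flag_count F d j.+1.
Proof.
move=> dimt; have := @card_subspaces_above _ _ d j.+1 0%VS tau (sub0v _).
rewrite dimv0 add0n card_top => <- //; congr (_ * _).
by apply: eq_card => W; rewrite !inE sub0v andbT.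
Qed.

Lemma card_star mu : \dim mu = j -> #|star mu| = points_count F (n.+1 - j).
Proof.
move=> dimm; have := card_covers (subvf mu); rewrite dimV dimm => <-.
rewrite -(card_imset _ (@val_inj _ _ point)); apply: eq_card => W; rewrite !inE subvf andbT.
apply/imsetP/andP => [[x] | [smW]].
  by rewrite inE => smx ->; rewrite smx dim_point dimm eqxx.
by rewrite dimm => dimW; exists (Sub W dimW : point); rewrite ?inE SubK.
Qed.

Lemma free_top x : exists tau, [/\ \dim tau = j.+2, (val x <= tau)%VS &
  {in G, forall a : {perm point}, [set a y | y in top tau] = top tau -> a = 1%g}].
Proof.
have [|v1 x'v1] := @ex_notin (val x); first by rewrite dim_point ltnW.
pose t1 := (val x + <[v1]>)%VS; have d1 : \dim t1 = j.+2 by rewrite dim_add_line ?dim_point.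
have [|v2 t1'v2] := @ex_notin t1; first by rewrite d1.
have x'v2 : v2 \notin val x by apply: contra t1'v2; apply/subvP/addvSl.
pose t2 := (val x + <[v2]>)%VS; have d2 : \dim t2 = j.+2 by rewrite dim_add_line ?dim_point.
have xt1 : x \in top t1 by rewrite inE addvSl.
have xt2 : x \in top t2 by rewrite inE addvSl.
have t2'v1 : v1 \notin t2.
  apply: contra t1'v2 => v1t2; have -> : t1 = t2; last by rewrite memvE addvSr.
  by apply/eqP; rewrite eqEdim d1 d2 leqnn subv_add addvSl -memvE v1t2.
(* A point through [v1] inside [t1] cannot lie in [t2]. *)
have neq : top t1 != top t2.
  have [||y /andP[vy yt1]] := @point_between <[v1]>%VS t1; first exact: addvSr.
    by rewrite dim_vline d1 leqnSn andbT; case: (v1 != _).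
  apply: contraNneq t2'v1 => E; have : y \in top t2 by rewrite -E inE.
  by rewrite inE memvE; apply: subv_trans.
have [|||B [BB Bx fB]] := @free_block _ G tops #|top t1| x cycG transG act_tops _ tops_meet
  (top t1) (top t2) _ _ neq xt1 xt2.
- move=> _ /imsetP[tau] + ->; rewrite inE => /eqP dimt; apply/eqP.
  rewrite -(eqn_pmul2r (flag_count_gt0 F 0 j.+1)).
  by rewrite !(@card_top_flags _ 1) ?addn1.
- by apply/imsetP; exists t1; rewrite ?inE ?d1.
- by apply/imsetP; exists t2; rewrite ?inE ?d2.
have /imsetP[tau] := BB; rewrite inE => /eqP dimt EB.
by exists tau; split=> //; [move: Bx; rewrite EB inE | rewrite -EB].
Qed.

Lemma free_star x : exists mu, [/\ \dim mu = j, (mu <= val x)%VS &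
  {in G, forall a : {perm point}, [set a y | y in star mu] = star mu -> a = 1%g}].
Proof.
have [|m1 [_ d1 sm1]] := @subspace_between _ _ 0%VS (val x) j (sub0v _).
  by rewrite dimv0 dim_point leqnSn.
have /subvPn[v xv m1'v] : ~~ (val x <= m1)%VS.
  by apply/negP=> /dimvS; rewrite dim_point d1 ltnn.
(* Here [0 < j] matters: a [j]-dimensional [m2] has room for [v], which separates it from [m1]. *)
have [||m2 [vm2 d2 sm2]] := @subspace_between _ _ <[v]>%VS (val x) j.
- by rewrite -memvE.
- by rewrite dim_vline dim_point leqnSn andbT; case: (v != _).
have gt1 : 1 < #|star m1|.
  rewrite card_star //; apply: leq_trans (@leq_points_count F 2 _ _); last first.
    by rewrite ltn_subRL addn1 ltnS ltnW // ltnW.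
  by rewrite /points_count big_ord_recl big_ord1 expn0 add1n ltnS ltnW // card_field_gt1.
(* If the stars agreed, any [y] other than [x] in them would make both [m1] and [m2] the meet of [x]
   and [y]; so the star would consist of [x] alone. *)
have neq : star m1 != star m2.
  apply: contraTneq gt1 => E; rewrite -leqNgt.
  suff /subset_leq_card : star m1 \subset [set x] by rewrite cards1.
  apply/subsetP=> y m1y; have m2y : y \in star m2 by rewrite -E.
  rewrite inE; apply: contraNT m1'v => yx; move: m1y m2y; rewrite !inE => m1y m2y.
  rewrite (near_meet_eq yx d1 m1y sm1) -(near_meet_eq yx d2 m2y sm2).
  by rewrite memvE.
have x1 : x \in star m1 by rewrite inE.
have x2 : x \in star m2 by rewrite inE.
have [|||B [BB Bx fB]] := @free_block _ G stars #|star m1| x cycG transG act_stars _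
  stars_meet (star m1) (star m2) _ _ neq x1 x2.
- by move=> _ /imsetP[mu] + ->; rewrite inE => /eqP dimm; rewrite !card_star.
- by apply/imsetP; exists m1; rewrite ?inE ?d1.
- by apply/imsetP; exists m2; rewrite ?inE ?d2.
have /imsetP[mu] := BB; rewrite inE => /eqP dimm EB.
by exists mu; split=> //; [move: Bx; rewrite EB inE | rewrite -EB].
Qed.

(* With [x1 = a x0], [x2 = b x0] on the pencil of a free top and a free star through
   [x0], the point [x3 = b x1 = a x2] is near both [x1] and [x2], so it lies in the top or
   in the star, which then shares [x1] and [x3] with its image under [a]. *)
Lemma no_regular_cyclic : False.
Proof.
have [|x0 _] := @point_between 0%VS fullv (sub0v _).
  by rewrite dimv0 dimV (leqW (ltnW ltjn)).
have [tau [dimt sxt freet]] := free_top x0; have [mu [dimm smx freem]] := free_star x0.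
have [x1 [x2 [[x01 x02 x12] []]]] := pencil smx sxt dimm dimt.
rewrite !inE => /andP[x1t x1m] /andP[x2t x2m].
have [a Ga ax] := transG x0 x1; have [b Gb bx] := transG x0 x2.
have [x3 bx1] : exists x3, b x1 = x3 by exists (b x1).
have ax2 : a x2 = x3.
  by rewrite -bx1 -ax -bx -!permM (centsP (cyclic_abelian cycG) a Ga b Gb).
have a1 : a != 1%g by apply: contraNneq x01 => a1; rewrite -ax a1 perm1.
have x13 : x1 != x3 by rewrite -ax -ax2 (inj_eq perm_inj); apply: x02.
have x23 : x2 != x3 by rewrite -bx -bx1 (inj_eq perm_inj); apply: x01.
have n01 := near_of_meet dimm smx x1m; have n02 := near_of_meet dimm smx x2m.
have n12 := near_of_meet dimm x1m x2m.
have n13 : near x1 x3 x3 by rewrite -ax -ax2 near_actE.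
have n23 : near x2 x3 x3 by rewrite -bx -bx1 near_actE.
have /orP[] := near_triple x12 x13 x23 n12 n13 n23.
  rewrite -(near_join_eq x12 dimt x1t x2t) => x3t; case/eqP: a1; apply: freet => //.
  have Ttop : top tau \in tops by apply/imsetP; exists tau; rewrite ?inE ?dimt.
  apply: (tops_meet (act_tops Ttop Ga) Ttop x13); rewrite ?inE //.
    by rewrite -ax imset_f // inE.
  by rewrite -ax2 imset_f // inE.
rewrite -(near_meet_eq x12 dimm x1m x2m) => x3m; case/eqP: a1; apply: freem => //.
have Sstar : star mu \in stars by apply/imsetP; exists mu; rewrite ?inE ?dimm.
apply: (stars_meet (act_stars Sstar Ga) Sstar x13); rewrite ?inE //.
  by rewrite -ax imset_f // inE.
by rewrite -ax2 imset_f // inE.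
Qed.

End Grassmann.

(** * The code and its cyclic shifts *)

Section Code.

Variables (p h j k n : nat) (F : finFieldType).
Hypotheses (p_pr : prime p) (cardF : #|F| = p ^ h) (ltjk : j < k) (ltkn : k < n).
Local Notation V := 'rV[F]_n.+1.
Local Notation point := (pspace j n F).
Local Notation block := (pspace k n F).

(** Extension by 0 to subspaces of every dimension, the form in which [balanced] and [support] take
    a word. *)
Definition extend (c : fspace p j n F) (U : {vspace V}) : 'F_p :=
  oapp c 0%R (insub U : option point).

Lemma extend_val c (x : point) : extend c (val x) = c x.
Proof. by rewrite /extend valK. Qed.

Lemma card_pspace (P : pred {vspace V}) :
  #|[set x : point | P (val x)]| = #|[set U : {vspace V} | (\dim U == j.+1) && P U]|.
Proof.
rewrite -(card_imset _ (@val_inj _ _ point)); apply: eq_card => U; rewrite !inE.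
apply/imsetP/andP => [[x] | [dimU PU]].
  by rewrite inE => Px ->; split; first exact: (valP x).
by exists (Sub U dimU : point); rewrite ?inE SubK.
Qed.

(** Only the term 1 survives, as [p] divides [q]; here [q > 1] excludes [h = 0]. *)
Lemma points_count_mod e : ((points_count F e.+1)%:R = 1 :> 'F_p)%R.
Proof.
have q0 : (#|F|%:R = 0 :> 'F_p)%R.
  rewrite cardF natrX pcharf0 ?pchar_Fp // expr0n -[h]prednK //.
  have := card_field_gt1 F; rewrite cardF; by case: (h).
rewrite /points_count big_ord_recl expn0 natrD natr_sum big1 ?addr0 // => i _.
by rewrite /bump /= expnS natrM q0 mul0r.
Qed.

(** The constant is 1 or 0 according to whether [kappa] contains [mu]. In the first case the
    dimension formula makes [sigma :&: kappa] larger than [mu], so [points_count_mod] applies. *)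
Lemma incvec_balanced (kappa : block) : balanced j.+1 k.+1 (extend (incvec p j kappa)).
Proof.
move=> mu [dim_mu]; exists ((mu <= val kappa)%VS%:R)%R => sigma sms dims.
transitivity (\sum_(lambda | covers mu lambda && (lambda <= sigma)%VS)
                 ((lambda <= val kappa)%VS : nat)%:R : 'F_p)%R.
  apply: eq_bigr => lambda /andP[/andP[_]]; rewrite dim_mu => diml _.
  by rewrite -(SubK point diml) extend_val ffunE.
rewrite -natr_sum.
have -> : \sum_(lambda | covers mu lambda && (lambda <= sigma)%VS)
            ((lambda <= val kappa)%VS : nat)
          = #|[set W | covers mu W && (W <= sigma :&: val kappa)%VS]|.
  rewrite -sum1dep_card (eq_bigl _ _ (fun W => congr1 _ (subv_cap W _ _))).
  rewrite (eq_bigl _ _ (fun W => andbA _ _ _)) [RHS]big_mkcondr.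
  by apply: eq_bigr => W _; case: ifP.
have [smk | nsmk] := boolP (mu <= val kappa)%VS; last first.
  rewrite (_ : [set _ | _] = set0) ?cards0 //; apply/setP=> W; rewrite !inE.
  apply: contraNF nsmk => /andP[/andP[smW _]]; rewrite subv_cap => /andP[_].
  exact: subv_trans.
rewrite card_covers ?subv_cap ?sms //.
have dimk : \dim (val kappa) = k.+1 by apply/eqP/(valP kappa).
have := dimv_sum_cap sigma (val kappa); rewrite dimk dims.
have := dimvS (subvf (sigma + val kappa)); rewrite dimvf /dim /= mul1n.
rewrite dim_mu => leDs Ds; set a := \dim _.
suff -> : a - j = (a - j).-1.+1 by rewrite points_count_mod.
by move: leDs Ds; rewrite -/a; clear; lia.
Qed.

Lemma code_balanced c : c \in pcode p j k n F -> balanced j.+1 k.+1 (extend c).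
Proof.
pose X := [seq incvec p j kappa | kappa : block] => Cc.
have -> : c = (\sum_i coord (in_tuple X) i c *: (in_tuple X)`_i)%R by apply: coord_span.
apply: (big_ind (fun d => balanced j.+1 k.+1 (extend d)))
  => [mu _|d e bd be mu dmu|i _ mu dmu].
- exists 0%R => sigma _ _; rewrite big1 // => W _.
  by rewrite /extend; case: insub => //= x; rewrite ffunE.
- have [[a Da] [b Db]] := (bd _ dmu, be _ dmu).
  exists (a + b)%R => sigma sms dims; rewrite -(Da sigma) // -(Db sigma) // -big_split.
  apply: eq_bigr => W _; rewrite /extend.
  by case: insub => [x|] /=; rewrite ?addr0 // ffunE.
have /imageP[kappa _ ->] : ((in_tuple X)`_i)%R \in X by apply: mem_nth.
have [a Da] := incvec_balanced kappa dmu; set t := coord _ _ _.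
exists (t * a)%R => sigma sms dims; rewrite -(Da sigma) // mulr_sumr.
apply: eq_bigr => W _; rewrite /extend.
by case: insub => [x|] /=; rewrite ?mulr0 // !ffunE.
Qed.

Lemma min_codeword c (kappa0 : block) : c \in pcode p j k n F -> c != 0%R ->
    #|[set x | c x != 0%R]| <= #|[set x : point | (val x <= val kappa0)%VS]| ->
  exists kappa : block, forall x, (c x != 0%R) = (val x <= val kappa)%VS.
Proof.
move=> Cc c0; have /= -> := card_pspace (fun U => U <= val kappa0)%VS.
rewrite -/(subspaces_of _ _) => lec.
have Ec : [set x | c x != 0%R] = [set x : point | extend c (val x) != 0%R].
  by apply/setP=> x; rewrite !inE extend_val.
have [||||kappa dimk Sk] :=
  min_support _ _ (code_balanced Cc) (isT : 0 < j.+1) (eqP (valP kappa0)).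
- by rewrite ltnS ltnW.
- by rewrite ltnS.
- apply: contraNneq c0 => S0; apply/eqP/ffunP=> x; rewrite ffunE.
  have /setP/(_ (val x)) := S0; rewrite !inE (valP x) extend_val /=.
  by move/negbFE/eqP.
- by move: lec; rewrite Ec; have /= -> := card_pspace (fun U => extend c U != 0%R).
have dimk' : \dim kappa == k.+1 by apply/eqP.
exists (Sub kappa dimk' : block) => x; rewrite SubK.
by have /setP/(_ (val x)) := Sk; rewrite !inE (valP x) extend_val.
Qed.

(** Speaks of blocks only, hence is carried along by any permutation of the points that preserves
    blocks; [near_hull] reads [near] from its size. *)
Definition hull (x y z : point) := [set u : point |
  [forall kappa : block,
    (val x + val y + val z <= val kappa)%VS ==> (val u <= val kappa)%VS]].

(** Climbs from [U] to dimension [k + 1] while avoiding the single cover [U + <[v]>]; [k < n] leaves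
    at least two covers at every step. *)
Lemma block_separating (U : {vspace V}) (v : V) :
  \dim U <= j.+2 -> v \notin U ->
  exists2 kappa : block, (U <= val kappa)%VS & v \notin val kappa.
Proof.
move=> dimU U'v; have cU := covers_add_line U'v.
have [||||W [sUW dimW avW]] := @subspace_avoiding _ _ U U [set (U + <[v]>)%VS] k.+1.
- move=> W /set1P->; rewrite cU; apply: contra U'v => /subvP; apply.
  by rewrite memvE addvSr.
- exact: subvv.
- by rewrite (leqW ltkn) (leq_trans dimU).
- rewrite cards1; apply: leq_trans (@leq_points_count F 2 _ _).
    by rewrite /points_count big_ord_recl big_ord1 expn0 add1n ltnS ltnW // card_field_gt1.
  by rewrite subSS ltnS subn_gt0.
move/eqP in dimW; exists (Sub W dimW : block); rewrite SubK //.
have := avW _ (set11 _); apply: contra => Wv.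
by rewrite subv_add sUW -memvE.
Qed.

(** If the span has dimension at most [j + 2], blocks through it separate it from every outside
    vector, so the hull is no larger than a top. Otherwise the hull contains a full top and one more
    point. *)
Lemma near_hull x y z :
  near x y z = (#|hull x y z| * flag_count F 0 j.+1 <= flag_count F 1 j.+1).
Proof.
rewrite /near; set U := (_ + val z)%VS.
have sub_hull : top j U \subset hull x y z.
  apply/subsetP=> u; rewrite !inE => suU; apply/forallP=> kappa; apply/implyP.
  exact: subv_trans.
apply/idP/idP => [leU | ].
  have [|tau [sUt dimt _]] := @subspace_between _ _ U fullv j.+2 (subvf _).
    by rewrite leU dimvf /dim /= mul1n ltnS (leq_trans ltjk) // ltnW.
  have {}dimt : \dim tau = j.+1 + 1 by rewrite addn1.
  rewrite -(card_top_flags dimt) leq_mul2r; apply/orP; right.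
  apply/subset_leq_card/subsetP=> u; rewrite !inE => /forallP hu.
  apply: subv_trans sUt; apply: contraT => /subvPn[v uv U'v].
  have [kappa sUk k'v] := block_separating leU U'v.
  by case/negP: k'v; apply: subvP uv; apply: implyP sUk.
apply: contraLR; rewrite -!ltnNge => ltU.
have [|tau [_ dimt stU]] := @subspace_between _ _ 0%VS U j.+2 (sub0v _).
  by rewrite dimv0 (ltnW ltU).
have dimt1 : \dim tau = j.+1 + 1 by rewrite addn1.
rewrite -(card_top_flags dimt1) ltn_pmul2r ?flag_count_gt0 //.
apply: leq_trans (subset_leq_card sub_hull); apply: proper_card; apply/properP; split.
  by apply/subsetP=> u; rewrite !inE => /subv_trans; apply.
have /subvPn[v Uv t'v] : ~~ (U <= tau)%VS.
  by apply/negP=> /dimvS; rewrite dimt leqNgt ltU.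
have [||u /andP[vu suU]] := @point_between j n F <[v]>%VS U.
- by rewrite -memvE.
- rewrite dim_vline (leq_trans _ (ltnW ltU)) ?andbT ?leqnSn //.
  by case: (v != _).
exists u; rewrite !inE //; apply: contra t'v => /subvP; apply.
by rewrite memvE.
Qed.

(** * Invariance of [near] under the successor permutation *)

Section CyclicShift.

Variable s : seq point.
Hypotheses (Us : uniq s) (s_full : forall x, x \in s).
Hypothesis shiftC : forall c : fspace p j n F,
  c \in pcode p j k n F -> cyclic_shift s c \in pcode p j k n F.

Let rho : {perm point} := perm (can_inj (prev_next Us)).

Let rhoE x : rho x = next s x. Proof. by rewrite permE. Qed.

(** The shifted word of [kappa] is a nonzero codeword with no more nonzero entries than [kappa] has
    points, so by [min_codeword] its support is again a block. *)
Lemma next_block (kappa : block) : exists kappa' : block,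
  forall x, (val x <= val kappa)%VS = (val (rho x) <= val kappa')%VS.
Proof.
pose c := cyclic_shift s (incvec p j kappa).
(* The shift reads at the predecessor, so supports move forward along [rho]. *)
have cE x : (c (rho x) != 0)%R = (val x <= val kappa)%VS.
  by rewrite !ffunE rhoE prev_next //; case: (_ <= _)%VS; rewrite ?oner_neq0 ?eqxx.
have Cc : c \in pcode p j k n F by apply/shiftC/memv_span/image_f.
have c_neq0 : c != 0%R.
  have [|x /andP[_ sxk]] := @point_between j n F 0%VS (val kappa) (sub0v _).
    by rewrite dimv0 dim_point (leqW ltjk).
  by apply: contraTneq sxk => c0; rewrite -cE c0 ffunE eqxx.
have [|kappa' ck'] := min_codeword (kappa0 := kappa) Cc c_neq0; last first.
  by exists kappa' => x; rewrite -ck' cE.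
rewrite -[leqRHS](card_imset _ (@perm_inj _ rho)); apply/subset_leq_card/subsetP=> y.
rewrite inE -{1}(permKV rho y) cE => sk; rewrite -(permKV rho y) imset_f //.
by rewrite inE.
Qed.

(** The group is finite, so natural powers of [rho] also account for inverses. *)
Lemma cycle_block a (kappa : block) : a \in <[rho]>%g -> exists kappa' : block,
  forall x, (val x <= val kappa)%VS = (val (a x) <= val kappa')%VS.
Proof.
case/cycleP=> i ->; elim: i => [|i [kappa1 IHi]].
  by exists kappa => x; rewrite expg0 perm1.
have [kappa2 k2] := next_block kappa1; exists kappa2 => x.
by rewrite expgSr permM -k2.
Qed.

Lemma hull_act a x y z u : a \in <[rho]>%g -> u \in hull x y z ->
  a u \in hull (a x) (a y) (a z).
Proof.
move=> Ga; rewrite !inE => /forallP hu; apply/forallP=> kappa.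
(* A block through the images is pulled back along the inverse of [a]. *)
have [kappa' kE] := cycle_block kappa (groupVr Ga).
have E w : (val w <= val kappa')%VS = (val (a w) <= val kappa)%VS by rewrite kE permK.
by rewrite !subv_add -!E -!subv_add.
Qed.

(** The inverse of [a] maps the hull of the images injectively into the original hull, and the size
    of the hull decides [near]. *)
Lemma near_cycle : {in <[rho]>%g, forall a : {perm point}, forall x y z,
  near x y z -> near (a x) (a y) (a z)}.
Proof.
move=> a Ga x y z; rewrite !near_hull; apply: leq_trans; rewrite leq_mul2r.
apply/orP; right; rewrite -(card_imset _ (@perm_inj _ (a^-1)%g)).
apply/subset_leq_card/subsetP=> _ /imsetP[u hu ->].
by have := hull_act (groupVr Ga) hu; rewrite !permK.
Qed.

Lemma cycle_transitive x y : exists2 a, a \in <[rho]>%g & a x = y.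
Proof.
have cyc : fcycle (next s) s := cycle_next Us.
have := fconnect_cycle cyc (s_full x) y; rewrite s_full => /iter_findex xy.
exists (rho ^+ findex (next s) x y)%g; first exact: mem_cycle.
by rewrite -{2}xy permX; apply: eq_iter => w; rewrite rhoE.
Qed.

Lemma shift_invariant_j0 : j = 0.
Proof.
apply/eqP; rewrite eqn0Ngt; apply/negP=> j_gt0.
apply: (@no_regular_cyclic j n F <[rho]>%G) => //.
- exact: cycle_cyclic.
- exact: cycle_transitive.
- exact: near_cycle.
exact: leq_ltn_trans ltkn.
Qed.

End CyclicShift.

End Code.

(** * Singer cycles *)

Section Singer.

Import passmx.
Local Open Scope ring_scope.

Variable F : finFieldType.

(** Takes a splitting field of [X^N - X] with [N = q^m]. The roots are distinct and form a subfield,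
    so they fill [L], which therefore has [N] elements. *)
Lemma finField_extension m : (0 < m)%N -> exists L : fieldExtType F, \dim {:L} = m.
Proof.
move=> m_gt0; set N := (#|F| ^ m)%N.
have N_gt1 : (1 < N)%N by rewrite -(expn0 #|F|) ltn_exp2l // card_field_gt1.
have szN (R : fieldType) : size ('X^N - 'X : {poly R}) = N.+1.
  by rewrite size_polyDl size_polyXn // size_polyN size_polyX.
have /FinSplittingFieldFor[L [zs]] : 'X^N - 'X != 0 :> {poly F}.
  by rewrite -size_poly_gt0 szN.
rewrite rmorphB rmorphXn /= map_polyX => DN defL; exists L.
have [p p_pr charF] := finPcharP F.
have N0 : N%:R = 0 :> L.
  have charL : p \in [pchar L] by rewrite pchar_lalg.
  have [e Dq] : exists e, #|F| = (p ^ e.+1)%N.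
    have := card_pprimeChar charF; case: (logn _ _) => [q1|e ->]; last by exists e.
    by have := card_field_gt1 F; rewrite q1.
  by rewrite /N Dq -expnM natrX pcharf0 // expr0n mulSn; case: (m) m_gt0.
have Uzs : uniq zs.
  rewrite -separable_prod_XsubC -(eqp_separable DN) unlock.
  (* The derivative is [-1], because [N] vanishes in [L]. *)
  rewrite derivB derivXn derivX -mulr_natr -[N%:R]polyC_natr N0 mulr0 sub0r.
  by rewrite coprimep_sym -scaleN1r coprimepZl ?oppr_eq0 ?oner_eq0 // coprime1p.
have [a _ Da] := finField_galois_generator (sub1v {:L}).
rewrite dimv1 expn1 in Da.
(* [a] raises to the power [q], so its [m]-th power fixes [z] exactly when [z] is a root. *)
pose E := fixedSpace (a ^+ m)%g; have zsE : zs =i E.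
  move=> z; rewrite -root_prod_XsubC -(eqp_root DN) (sameP fixedSpaceP eqP).
  rewrite /root !hornerE subr_eq0 /N; congr (_ == z).
  elim: (m) => [|i IHi]; first by rewrite gal_id.
  by rewrite expgSr expnSr exprM IHi galM ?Da ?memvf.
have EL : E = {:L}%VS.
  apply/eqP; rewrite eqEsubv subvf -defL -[E]subfield_closed agenvS //.
  by rewrite subv_add sub1v; apply/span_subvP=> z; rewrite zsE.
have cardL : #|({:L}%VS : {vspace finvect_type L})| = size zs.
  rewrite -(@card_uniqP (finvect_type L) zs Uzs); apply: eq_card => z.
  by rewrite [RHS]zsE EL.
apply/eqP; rewrite -(eqn_exp2l _ _ (card_field_gt1 F)); apply/eqP.
rewrite -/N; apply: succn_inj; rewrite -(szN L) (eqp_size DN) size_prod_XsubC -cardL.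
by rewrite card_vspace.
Qed.

Lemma finField_primitive (L : finFieldType) :
  exists2 w : L, w != 0 & forall x, x != 0 -> exists i, x = w ^+ i.
Proof.
have /cyclicP[w Dw] := field_unit_group_cyclic [set: {unit L}]%G.
exists (val w) => [|x x0]; first by rewrite -unitfE (valP w).
have Ux : x \is a GRing.unit by rewrite unitfE.
have : FinRing.unit L Ux \in <[w]>%g by rewrite -Dw inE.
by case/cycleP=> i /(congr1 val) /= Dx; exists i; rewrite Dx FinRing.val_unitX.
Qed.

(** Multiplication by a primitive element of the extension, carried to row vectors by a basis. *)
Lemma singer_cycle m : (0 < m)%N -> exists2 phi : 'End('rV[F]_m), lker phi == 0%VS &
  forall u v, u != 0 -> v != 0 -> exists i, iter i phi u = v.
Proof.
case/finField_extension=> L <- {m}.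
have [w w0 wP] : exists2 w : L, w != 0 & forall x, x != 0 -> exists i, x = w ^+ i.
  exact: (finField_primitive (FinFieldExtType L)).
set e := vbasis {:L}; have be : basis_of fullv e := vbasisP _.
pose phi : 'End('rV[F]_(\dim {:L})) := linfun (mulmxr (mxof e e (amull w))).
have phiE u : vecof e (phi u) = w * vecof e u.
  by rewrite lfunE /= mul_mxof ?rVofK // lfunE.
have vecof_inj : injective (vecof e) := can_inj (vecofK be).
exists phi.
  by apply/lker0P=> u v /(congr1 (vecof e)); rewrite !phiE => /(mulfI w0)/vecof_inj.
move=> u v u0 v0; have vecof0 x : x != 0 -> vecof e x != 0 by rewrite vecof_eq0.
have [i Dv] := wP (vecof e v / vecof e u) (mulf_neq0 (vecof0 _ v0) (invr_neq0 (vecof0 _ u0))).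
exists i; apply: vecof_inj; rewrite -[RHS](divfK (vecof0 _ u0)) Dv.
elim: i {Dv} => [|i IHi]; first by rewrite mul1r.
by rewrite /= phiE IHi mulrA -exprS.
Qed.

End Singer.

(** * Cyclicity of the code of points *)

Section CyclicPoints.

Variables (p k n : nat) (F : finFieldType).
Local Notation V := 'rV[F]_n.+1.
Local Notation point := (pspace 0 n F).

(** The shift is linear, so checking the spanning words suffices. *)
Lemma cyclic_shift_span (T : finType) (K : fieldType) (s : seq T)
    (X : seq {ffun T -> K^o}) (C : {vspace {ffun T -> K^o}}) :
    {in X, forall c, cyclic_shift s c \in C} ->
  {in <<X>>%VS, forall c, cyclic_shift s c \in C}.
Proof.
move=> XC c /(@coord_span _ _ _ (in_tuple X)) ->.
have -> : cyclic_shift s (\sum_i coord (in_tuple X) i c *: (in_tuple X)`_i)%R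
    = (\sum_i coord (in_tuple X) i c *: cyclic_shift s (in_tuple X)`_i)%R.
  apply/ffunP=> x; rewrite ffunE !sum_ffunE; apply: eq_bigr => i _.
  by rewrite !ffunE.
by apply: memv_suml => i _; rewrite memvZ // XC // mem_nth.
Qed.

Lemma point_line (x : point) : exists2 v : V, v != 0%R & val x = <[v]>%VS.
Proof.
have dimx : \dim (val x) = 1 := eqP (valP x).
have v0 : vpick (val x) != 0%R by rewrite vpick0 -dimv_eq0 dimx.
exists (vpick (val x)) => //; apply/esym/eqP; rewrite eqEdim dimx dim_vline v0 andbT.
by rewrite -memvE memv_pick.
Qed.

Lemma points_cyclic : cyclic_equivalent (pcode p 0 k n F).
Proof.
have [phi ker_phi trans] := singer_cycle F (ltn0Sn n).
have phi_inj := lker0P ker_phi.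
have dim_phi d (U : {vspace V}) : \dim U == d -> \dim (phi @: U) == d.
  by rewrite limg_dim_eq // (eqP ker_phi) capv0.
have phi_sub (U W : {vspace V}) : (phi @: U <= phi @: W)%VS = (U <= W)%VS.
  apply/idP/idP => [/subvP sUW | /limgS //]; apply/subvP=> v Uv.
  have /sUW/memv_imgP[w Ww /phi_inj-> //] : phi v \in (phi @: U)%VS by apply: memv_img.
pose rho (x : point) : point := Sub (phi @: val x)%VS (dim_phi _ _ (valP x)).
have rho_inj : injective rho.
  move=> x y /(congr1 val); rewrite !SubK => E; apply/val_inj/eqP.
  by rewrite eqEsubv -(phi_sub (val x)) -(phi_sub (val y)) E subvv.
have [v0 v00] : exists v : V, v != 0%R.
  by exists (const_mx 1%R); apply/eqP=> /rowP/(_ ord0)/eqP; rewrite !mxE oner_eq0.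
have dim_v0 : \dim <[v0]>%VS == 1 by rewrite dim_vline v00.
pose x0 : point := Sub <[v0]>%VS dim_v0.
have conn x : x \in fingraph.orbit rho x0.
  have [v vn Ex] := point_line x; have [i Dv] := trans v0 v v00 vn.
  suff -> : x = iter i rho x0 by rewrite -fconnect_orbit fconnect_iter.
  apply: val_inj; rewrite Ex -Dv; elim: i {Dv} => [|i IHi]; first by [].
  by rewrite !iterS SubK -IHi limg_line.
(* The ordering is the orbit of one point under [rho], which by [conn] contains every point. *)
exists (fingraph.orbit rho x0); first by split; first exact: orbit_uniq.
apply: cyclic_shift_span => _ /imageP[kappa _ ->].
pose kappa' : pspace k n F := Sub (phi @: val kappa)%VS (dim_phi _ _ (valP kappa)).
(* The predecessor of [x] is its preimage under [rho], so shifting replaces [kappa] by its image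
   under [phi]. *)
have -> : cyclic_shift (fingraph.orbit rho x0) (incvec p 0 kappa) = incvec p 0 kappa'.
  apply/ffunP=> x; rewrite !ffunE; set y := prev _ x.
  have /eqP <- : rho y == x := prev_cycle (cycle_orbit rho_inj x0) (conn x).
  by rewrite !SubK phi_sub.
exact/memv_span/image_f.
Qed.

End CyclicPoints.

Theorem theorem6p10 (p h j k n : nat) (F : finFieldType) (p_pr : prime p)
    (cardF : #|F| = (p ^ h)%N) (ltjk : (j < k)%N) (ltkn : (k < n)%N) :
  cyclic_equivalent (pcode p j k n F) <-> j = 0%N.
Proof.
split=> [[s [Us s_full] shiftC] | ->]; last exact: points_cyclic.
exact: shift_invariant_j0 p_pr cardF ltjk ltkn _ Us s_full shiftC.
Qed.
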